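(* Let $P\in\mathbb{R}^{n\times n}$ be an irreducible row-stochastic matrix that is reversible with respect to its stationary distribution $\pi$, and let $B\subseteq\{1,\dots,n\}$ be an independent set of $P$. Let $x_t\in\mathbb{R}^n$, let $x_{t+1}=x_t-x_t(I-P)I_{B}$ be the RLGL update, and set $y_t=x_t\Pi^{-1/2}$, $y_{t+1}=x_{t+1}\Pi^{-1/2}$. Then the RLGL update is a block descent update for the Dirichlet energy $\mathcal{E}$ with optimal step size in the symmetrized coordinates: $$y_{t+1}=y_t-\alpha\odot\nabla\mathcal{E}(y_t)\,I_{B}\quad\text{with }\alpha=(1,\dots,1),$$ and this $\alpha$ is optimal, i.e. it minimizes $\alpha'\mapsto\mathcal{E}\big(y_t-\alpha'\odot\nabla\mathcal{E}(y_t)I_{B}\big)$ over all $\alpha'\in\mathbb{R}^n$.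
   Context: Vectors are row vectors. $\pi$ is the unique positive probability row vector with $\pi P=\pi$, and $\Pi=\mathrm{diag}(\pi)$. Reversible means $\pi_iP_{ij}=\pi_jP_{ji}$ for all $i,j$. $I_B$ is the diagonal $0/1$ matrix projecting on the coordinates in $B$; $\odot$ is the entrywise (Hadamard) product. A set $B$ is independent for $P$ if $P_{ij}=0$ for all $i,j\in B$ (including $i=j$, so nodes of $B$ have no self-loops). For reversible $P$ let $\mathcal{L}=I-\Pi^{1/2}P\Pi^{-1/2}$ (a symmetric positive semidefinite matrix); the Dirichlet energy is $\mathcal{E}(y)=\tfrac12\,y\mathcal{L}y^\top$, with gradient (row vector) $\nabla\mathcal{E}(y)=y\mathcal{L}$. A block descent update of $\mathcal{E}$ on block $B$ with (per-coordinate) step sizes $\alpha\in\mathbb{R}^n$ is $y\mapsto y-\alpha\odot\nabla\mathcal{E}(y)I_B$. *)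

(* Defs.v *)
From mathcomp Require Import all_boot all_order all_algebra.
From mathcomp Require Import reals normedtype derive.

Set Implicit Arguments.
Unset Strict Implicit.
Unset Printing Implicit Defensive.

Import Order.TTheory GRing.Theory Num.Theory.
Import numFieldNormedType.Exports.

Local Open Scope ring_scope.

(* Vectors are row vectors ['rV[R]_n] and coordinates are indexed by ['I_n]. *)

Definition row_stochastic (R : realType) n (P : 'M[R]_n) : Prop :=
  (forall i j, 0 <= P i j) /\ (forall i, \sum_j P i j = 1).

Definition irreducible (R : realType) n (P : 'M[R]_n) : Prop :=
  forall i j, exists k : nat, 0 < (P ^+ k) i j.

Definition stationary_distribution (R : realType) n
    (P : 'M[R]_n) (pi : 'rV[R]_n) : Prop :=
  [/\ forall i, 0 < pi 0 i, \sum_i pi 0 i = 1 & pi *m P = pi].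

Definition reversible (R : realType) n (P : 'M[R]_n) (pi : 'rV[R]_n) : Prop :=
  forall i j, pi 0 i * P i j = pi 0 j * P j i.

(* The case [i = j] is included: nodes of [B] carry no self-loop. *)
Definition independent (R : realType) n (P : 'M[R]_n) (B : {set 'I_n}) : Prop :=
  forall i j, i \in B -> j \in B -> P i j = 0.

Definition block_proj (R : realType) n (B : {set 'I_n}) : 'M[R]_n :=
  diag_mx (\row_i (i \in B)%:R).

Definition hadamard (R : realType) n (u v : 'rV[R]_n) : 'rV[R]_n :=
  map2_mx *%R u v.

(* $\Pi^{1/2}$ and $\Pi^{-1/2}$ for $\Pi = \mathrm{diag}(\pi)$. *)
Definition Pi_sqrt (R : realType) n (pi : 'rV[R]_n) : 'M[R]_n :=
  diag_mx (map_mx Num.sqrt pi).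

Definition Pi_isqrt (R : realType) n (pi : 'rV[R]_n) : 'M[R]_n :=
  diag_mx (map_mx (fun a => (Num.sqrt a)^-1) pi).

Definition sym_laplacian (R : realType) n
    (P : 'M[R]_n) (pi : 'rV[R]_n) : 'M[R]_n :=
  1%:M - Pi_sqrt pi *m P *m Pi_isqrt pi.

(* The product [y *m L *m y^T] is a 1 x 1 matrix, read off at entry (0, 0). *)
Definition dirichlet_energy (R : realType) n
    (P : 'M[R]_n) (pi : 'rV[R]_n) (y : 'rV[R]_n) : R :=
  2^-1 * (y *m sym_laplacian P pi *m y^T) 0 0.

(* Row vector of partial derivatives. For the Dirichlet energy of a reversible
   chain it equals [y *m sym_laplacian P pi], the Laplacian being symmetric. *)
Definition gradient (R : realType) n (f : 'rV[R]_n -> R) (y : 'rV[R]_n) :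
    'rV[R]_n :=
  \row_j 'D_(delta_mx 0 j) f y.

Definition block_descent (R : realType) n (f : 'rV[R]_n -> R)
    (B : {set 'I_n}) (alpha y : 'rV[R]_n) : 'rV[R]_n :=
  y - hadamard alpha (gradient f y) *m block_proj R B.

Definition optimal_step (R : realType) n (f : 'rV[R]_n -> R)
    (B : {set 'I_n}) (y alpha : 'rV[R]_n) : Prop :=
  forall alpha' : 'rV[R]_n,
    f (block_descent f B alpha y) <= f (block_descent f B alpha' y).

Definition rlgl_update (R : realType) n (P : 'M[R]_n) (B : {set 'I_n})
    (x : 'rV[R]_n) : 'rV[R]_n :=
  x - x *m (1%:M - P) *m block_proj R B.

(* Main.v *)
Require Import Defs.
From mathcomp Require Import all_boot all_order all_algebra.
From mathcomp Require Import classical_sets reals topology normedtype derive.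
From mathcomp Require Import ring lra.

Import Order.TTheory GRing.Theory Num.Theory.
Import numFieldNormedType.Exports.

Local Open Scope ring_scope.

(** Write [L] for the symmetrized Laplacian and [g = y L] for the gradient of
    the energy. Diagonal matrices commute, so [x (I - P) I_B Pi^(-1/2) = g I_B],
    which is the descent identity with unit step. For the optimality, [L]
    restricted to [B] x [B] is the identity because [P] vanishes there; hence
    the energy after the step is
    [E y + \sum_(i in B) (2^-1 * a_i^2 - a_i) * g_i^2], and every coefficient
    is minimal at [a_i = 1]. *)

(** A 1 x 1 matrix is its own transpose, so for symmetric [L] the two cross terms agree and absorb
    the factor 1/2. *)
Lemma quadratic_formD (R : realType) n (L : 'M[R]_n) (y d : 'rV[R]_n) :
  L^T = L ->
  2^-1 * ((y + d) *m L *m (y + d)^T) 0 0 =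
  2^-1 * (y *m L *m y^T) 0 0 + (y *m L *m d^T) 0 0
  + 2^-1 * (d *m L *m d^T) 0 0.
Proof.
move=> symL; have dLy : (d *m L *m y^T) 0 0 = (y *m L *m d^T) 0 0.
  by rewrite -[d *m L *m y^T]trmxK mxE !trmx_mul trmxK symL mulmxA.
rewrite linearD /= mulmxDl mulmxDl !mulmxDr.
have add00 (u w : 'M[R]_1) : (u + w) 0 0 = u 0 0 + w 0 0 by rewrite mxE.
rewrite !add00 dLy.
by field.
Qed.

Local Open Scope classical_set_scope.

(** By the expansion above, the difference quotient along a basis vector [v] is affine in the
    increment: [y L v^T + h * c]. Its limit at 0 is the constant term. *)
Lemma gradient_quadratic_form (R : realType) n (L : 'M[R]_n) (y : 'rV[R]_n) :
  L^T = L ->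
  gradient (fun z => 2^-1 * (z *m L *m z^T) 0 0) y = y *m L.
Proof.
move=> symL; apply/rowP => j; rewrite mxE.
set v := delta_mx 0 j.
set c := 2^-1 * (v *m L *m v^T) 0 0.
have -> : (y *m L) 0 j = (y *m L *m v^T) 0 0.
  by rewrite trmx_delta -colE [RHS]mxE.
apply: cvg_lim => //.
apply: (@cvg_trans _ ((fun h : R => (y *m L *m v^T) 0 0 + h * c) @ 0^')).
  apply: near_eq_cvg; near=> h.
  have h0 : h != 0 by near: h; exact: nbhs_dnbhs_neq.
  rewrite /= [h *: v + y]addrC quadratic_formD// linearZ /= -!scalemxAl -!scalemxAr.
  have scale00 (k : R) (u : 'M[R]_1) : (k *: u) 0 0 = k * u 0 0 by rewrite mxE.
  rewrite !scale00 /c /GRing.scale /=.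
  by field.
set b := (y *m L *m v^T) 0 0.
(* The limit is put in the shape of the function, so that the limit rules for sums and products
   apply termwise. *)
have {2}-> : b = b + 0 * c by rewrite mul0r addr0.
apply: cvgD; first exact: cvg_cst.
by apply: cvgM; [exact: (@cvg_within _ (nbhs (0 : R)))|exact: cvg_cst].
Unshelve. all: by end_near. Qed.

Local Close Scope classical_set_scope.

Lemma sym_laplacianE (R : realType) n (P : 'M[R]_n) (pi : 'rV[R]_n) i j :
  sym_laplacian P pi i j =
  (i == j)%:R - Num.sqrt (pi 0 i) * P i j * (Num.sqrt (pi 0 j))^-1.
Proof.
by rewrite /sym_laplacian /Pi_sqrt /Pi_isqrt mul_mx_diag mul_diag_mx !mxE.
Qed.

(** After multiplication by [sqrt (pi_i) * sqrt (pi_j)], symmetry of the entries is detailed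
    balance. *)
Lemma sym_laplacian_tr (R : realType) n (P : 'M[R]_n) (pi : 'rV[R]_n) :
  (forall i, 0 < pi 0 i) -> reversible P pi ->
  (sym_laplacian P pi)^T = sym_laplacian P pi.
Proof.
move=> pi_gt0 rev; apply/matrixP => i j; rewrite mxE !sym_laplacianE eq_sym.
congr (_ - _).
have si : Num.sqrt (pi 0 i) != 0 by rewrite gt_eqF ?sqrtr_gt0.
have sj : Num.sqrt (pi 0 j) != 0 by rewrite gt_eqF ?sqrtr_gt0.
apply: (mulIf si); apply: (mulIf sj); rewrite mulfVK//.
rewrite [RHS]mulrAC mulfVK// mulrAC -expr2 sqr_sqrtr ?ltW// -rev.
by rewrite mulrAC -expr2 sqr_sqrtr ?ltW.
Qed.

(** The inner factors [Pi^(-1/2) Pi^(1/2)] cancel: the change of coordinates carries the residual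
    [x (I - P)] to the gradient of the energy. *)
Lemma mul_sym_laplacian (R : realType) n (P : 'M[R]_n) (pi x : 'rV[R]_n) :
  (forall i, 0 < pi 0 i) ->
  x *m Pi_isqrt pi *m sym_laplacian P pi = x *m (1%:M - P) *m Pi_isqrt pi.
Proof.
move=> pi_gt0.
have isqrtK : Pi_isqrt pi *m Pi_sqrt pi = 1%:M.
  rewrite /Pi_isqrt /Pi_sqrt mulmx_diag -diag_const_mx; congr diag_mx.
  by apply/rowP => i; rewrite !mxE mulVf// gt_eqF ?sqrtr_gt0.
rewrite /sym_laplacian !mulmxBr !mulmx1 mulmxBl !mulmxA.
by rewrite -(mulmxA x) isqrtK mulmx1.
Qed.

Lemma gradient_dirichlet_energy (R : realType) n (P : 'M[R]_n)
    (pi y : 'rV[R]_n) :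
  (forall i, 0 < pi 0 i) -> reversible P pi ->
  gradient (dirichlet_energy P pi) y = y *m sym_laplacian P pi.
Proof.
by move=> pi_gt0 rev; apply/gradient_quadratic_form/sym_laplacian_tr.
Qed.

Lemma mul_block_projE (R : realType) n (B : {set 'I_n}) (u : 'rV[R]_n) i :
  (u *m block_proj R B) 0 i = u 0 i * (i \in B)%:R.
Proof. by rewrite mul_mx_diag !mxE. Qed.

Lemma independent_dirichlet_energy (R : realType) n (P : 'M[R]_n)
    (pi : 'rV[R]_n) (B : {set 'I_n}) (d : 'rV[R]_n) :
  independent P B -> (forall i, i \notin B -> d 0 i = 0) ->
  dirichlet_energy P pi d = 2^-1 * \sum_i d 0 i ^+ 2.
Proof.
move=> indep dB; rewrite /dirichlet_energy mxE; congr (_ * _).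
apply: eq_bigr => j _; rewrite !mxE expr2.
have [jB|/dB ->] := boolP (j \in B); last by rewrite !mulr0.
congr (_ * _).
(* The diagonal entry is 1 since [j] has no self-loop. An off-diagonal term vanishes through [P i j]
   if [i] is in [B], and through [d 0 i] otherwise. *)
rewrite (bigD1 j)//= sym_laplacianE eqxx indep// mulr0 mul0r subr0 mulr1.
rewrite big1 ?addr0// => i ij; rewrite sym_laplacianE (negbTE ij).
have [iB|/dB ->] := boolP (i \in B); last by rewrite mul0r.
by rewrite indep// mulr0 mul0r subr0 mulr0.
Qed.

Lemma block_descent_dirichlet_energy (R : realType) n (P : 'M[R]_n)
    (pi y a : 'rV[R]_n) (B : {set 'I_n}) :
  (forall i, 0 < pi 0 i) -> reversible P pi -> independent P B ->
  dirichlet_energy P pi (block_descent (dirichlet_energy P pi) B a y) =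
  dirichlet_energy P pi y +
  \sum_(i in B) (2^-1 * a 0 i ^+ 2 - a 0 i) *
                (y *m sym_laplacian P pi) 0 i ^+ 2.
Proof.
move=> pi_gt0 rev indep.
rewrite /block_descent gradient_dirichlet_energy//.
set g := y *m _; set d := - (hadamard a g *m block_proj R B).
have dE i : d 0 i = - (a 0 i * g 0 i * (i \in B)%:R).
  by rewrite [LHS]mxE mul_block_projE mxE.
rewrite {1}/dirichlet_energy quadratic_formD ?sym_laplacian_tr//.
(* The step [d] is supported on [B], so its own energy is half its squared norm; the cross term
   supplies [- a_i * g_i^2]. *)
rewrite -!/(dirichlet_energy _ _ _) (independent_dirichlet_energy _ _ _ _ B d)//.
  rewrite -addrA; congr (_ + _).
  rewrite mxE mulr_sumr -big_split [RHS]big_mkcond /=; apply: eq_bigr => i _.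
  rewrite [d^T i 0]mxE dE -/g; case: (i \in B) => /=; first by field.
  by rewrite !mulr0 !oppr0 expr0n /= !mulr0 addr0.
by move=> i /negbTE iB; rewrite dE iB mulr0 oppr0.
Qed.

Theorem theorem3 (R : realType) (n : nat) (P : 'M[R]_n) (pi : 'rV[R]_n)
    (B : {set 'I_n}) (x_t x_t1 y_t y_t1 : 'rV[R]_n)
    (P_stochastic : row_stochastic P)
    (P_irreducible : irreducible P)
    (pi_stationary : stationary_distribution P pi)
    (P_reversible : reversible P pi)
    (B_independent : independent P B)
    (x_t1E : x_t1 = rlgl_update P B x_t)
    (y_tE : y_t = x_t *m Pi_isqrt pi)
    (y_t1E : y_t1 = x_t1 *m Pi_isqrt pi) :
  y_t1 = block_descent (dirichlet_energy P pi) B (const_mx 1) y_t /\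
  optimal_step (dirichlet_energy P pi) B y_t (const_mx 1).
Proof.
have [pi_gt0 _ _] := pi_stationary; split.
  rewrite /block_descent gradient_dirichlet_energy// y_t1E x_t1E y_tE.
  rewrite mul_sym_laplacian// mulmxBl; congr (_ - _).
  have -> (u : 'rV[R]_n) : hadamard (const_mx 1) u = u.
    by apply/rowP => i; rewrite !mxE mul1r.
  (* Only the order of the diagonal factors [I_B] and [Pi^(-1/2)] differs. *)
  by rewrite -!mulmxA; congr (_ *m (_ *m _)); exact: diag_mxC.
move=> a; rewrite !block_descent_dirichlet_energy// lerD2l.
apply: ler_sum => i _; rewrite mxE ler_wpM2r ?sqr_ge0//.
(* The gap between the two coefficients is [(a_i - 1)^2 / 2]. *)
have := sqr_ge0 (a 0 i - 1); nra.
Qed.
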